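(* We have $f(4)=8$, $f(5)=13$, $f(6)=19$, and $f(7)=24$.
   Context: For a positive integer $n$ write $\mathbb{Z}_n=\mathbb{Z}/n\mathbb{Z}$. For a subset $B$ of $\mathbb{Z}_n$ let $\Sigma(B)=\{\sum_{b\in C} b \mid C\subset B\}$ be the set of all subset sums of $B$ (the empty subset $C=\emptyset$ is included and contributes $0$). The set $B$ is called zero-sum free if no non-empty subset of $B$ has sum $0$. For positive integers $n,k$ define $f_n(k)=\min_B\left(|\Sigma(B)|-1\right)$, where $B$ runs over all zero-sum free subsets of $\mathbb{Z}_n$ with exactly $k$ (distinct) elements; if there is no such $B$, set $f_n(k)=\infty$. Define $f(k)=\min_{n\ge 1} f_n(k)$. *)

(* Defs.v *)
From HB Require Import structures.
From mathcomp Require Import all_boot all_order all_algebra.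
From mathcomp Require Import boolp.

Set Implicit Arguments.
Unset Strict Implicit.
Unset Printing Implicit Defensive.

Import GRing.Theory.

Section SubsetSums.
Variable G : finZmodType.
Implicit Type B : {set G}.

Definition subset_sums B : {set G} :=
  [set (\sum_(b in C) b)%R | C : {set G} in powerset B].

Definition zero_sum_free B : Prop :=
  forall C : {set G}, C \subset B -> C != set0 -> (\sum_(b in C) b)%R <> 0%R.

End SubsetSums.

(* Values in {0, 1, 2, ...} together with infinity are encoded in [option nat],
   [None] being infinity, which is the minimum of the empty set. *)
Definition min_nat (P : nat -> Prop) : option nat :=
  if pselect (exists m, `[< P m >]) is left exP then Some (ex_minn exP)
  else None.

(* For n >= 1, Z/nZ is 'I_n.-1.+1, i.e. 'I_n with addition modulo n; 'Z_n would
   be Z/2Z for n = 1. *)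
Definition f_mod (n k : nat) : option nat :=
  min_nat (fun m => exists B : {set 'I_n.-1.+1},
    [/\ zero_sum_free B, #|B| = k & m = #|subset_sums B| - 1]).

(* The n with [f_mod n k = None] do not contribute to the minimum. *)
Definition f (k : nat) : option nat :=
  min_nat (fun m => exists2 n, 0 < n & f_mod n k = Some m).

(* Main.v *)
Require Import Defs.
From mathcomp Require Import all_boot all_algebra all_fingroup cyclic.
From mathcomp Require Import boolp zify.

(** The text is written in the multiplicative language of finite groups: in
    Z_n, x * y is the sum, 1 is zero, S :* d is the translate S + d, and D ^+ j
    is the j-fold sumset of D.

    Let B be zero-sum free with k elements, S the set of its subset sums and,
    for b in B, T the set of subset sums of B \ b.  Then S is the union of T
    and T + b.  For k = 4, 5, 6, 7 one has to show that |S| is at least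
    9, 14, 20, 25.  Equality is attained in Z_9, Z_14, Z_20, Z_25, where a
    zero-sum free set with k elements is enough since |S| <= n.

    For d in the group let the defect of d be |(S + d) \ S|.  It is symmetric
    and subadditive in d, and the defect of an element b of B is at most
    |S| - |T| ([defect_subset_sums]).  So if |S| is close to the bound known for
    k - 1, all elements of D, made of 0, B and -B, have defect at most some
    small m, and the elements of the j-fold sumset of D have defect at most
    jm.  The sum over all d of |S| - defect d is |S|^2, which bounds the sizes
    of these sumsets from above ([card_defect_layers]).  On the other hand they
    grow: by the isoperimetric method the smallest value of |X + D| - |X|, over
    the nonempty X such that X + D is not the whole group, is attained by a
    subgroup ([atom_subgroup]), and since D is symmetric and may be assumed to
    generate the group this value is at least 2|D|/3 ([expands_two_thirds]).
    If B generates Z_n and n >= 36, the two estimates contradict each other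
    for k = 2, 3, 4, 7.

    For k = 5 and k = 6 they do not: the bounds are attained by infinite
    families, such as 1, 2, h, 1 + h, 2 + h with 2h = 0, to which 3 is added if
    k = 6.  If B has no involution, better bounds for 3, 4 and 5 elements (7, 11
    and 15) make the estimates succeed; the bound 11 can fail only when D is a
    union of three cosets of a subgroup of order 3, and then a further element
    creates at least five new sums ([periodic_defect]).  If B contains an
    involution h, then S is invariant under h, so that |S| is even and h has
    defect 0 ([sums_ge_stab]).

    The moduli n <= 35 are settled by a search ([search_upto_sound]).  If B
    generates a proper subgroup, it can be seen in a smaller modulus
    ([reduce_modulus]); if B does but B \ b does not generate Z_n, then T and
    T + b are disjoint, which is more than enough ([subset_sums_double]). *)

Set Implicit Arguments.
Unset Strict Implicit.
Unset Printing Implicit Defensive.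

Import GroupScope.

(** * Isoperimetry in finite groups *)

(** Two occurrences of the same cardinal may involve convertible but distinct
    canonical structures, which the arithmetic tactics treat as different
    unknowns; naming each cardinal up to conversion merges them. *)
Ltac name_cards := repeat match goal with
  | |- context [@card.body ?T ?A] =>
      let c := fresh "c" in set c := (@card.body T A); move: c => c
  end.
Ltac card_lia := name_cards; lia.
Ltac card_nia := name_cards; nia.

Section Isoperimetry.
Variable (gT : finGroupType) (D : {set gT}).
Hypotheses (D1 : 1 \in D) (DV : D^-1 = D).

Let frag (X : {set gT}) := (X != set0) && (X * D != setT).

Let subMD (X : {set gT}) : X \subset X * D.
Proof. by apply/subsetP=> x Xx; rewrite -(mulg1 x) mem_mulg. Qed.

Let bd (X : {set gT}) := #|X * D| - #|X|.

Let bd_le (X Y : {set gT}) : (bd X <= bd Y) = (#|X * D| + #|Y| <= #|Y * D| + #|X|).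
Proof.
rewrite /bd; have := subset_leq_card (subMD X); have := subset_leq_card (subMD Y).
card_lia.
Qed.

(* With Y the complement of XD, the set YD avoids X because D is symmetric. *)
Let dual (X : {set gT}) : frag X -> frag (~: (X * D)) /\ bd (~: (X * D)) <= bd X.
Proof.
case/andP=> X0 XD.
have sub : ~: (X * D) * D \subset ~: X.
  apply/subsetP=> _ /mulsgP[y d Yy Dd ->]; rewrite inE; apply: contraL Yy => Xyd.
  rewrite inE negbK -(mulgK d y) mem_mulg //.
  by rewrite -DV mem_invg invgK.
split.
  apply/andP; split.
    by apply: contra XD => /eqP E; rewrite -[X * D]setCK E setC0.
  apply: contra X0 => /eqP E; move: sub; rewrite E subTset => /eqP E'.
  by rewrite -[X]setCK E' setCT.
have := subset_leq_card sub; have := subset_leq_card (subMD X).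
have := cardsC X; have := cardsC (X * D).
rewrite /bd; card_lia.
Qed.

(** An atom is a set X of least size among those that minimise |XD| - |X|
    (with X nonempty and XD not the whole group).  By submodularity two atoms
    that meet are equal: otherwise their intersection is too small to be
    minimal, so their union beats the minimum and must satisfy XD = G, which
    is impossible because the complement of AD is minimal too, hence no
    smaller than the atom A.  The translates of an atom are atoms, so an atom
    that contains 1 is a subgroup. *)
Lemma atom_subgroup : D != setT ->
  exists K : {group gT}, K * D != setT /\
    forall X : {set gT}, X != set0 -> X * D != setT ->
      #|K * D| + #|X| <= #|X * D| + #|K|.
Proof.
move=> DnT.
have frag1 : frag [set 1].
  by rewrite /frag mul1g DnT andbT; apply/set0Pn; exists 1; rewrite inE.
(* Minimising w minimises bd first and the size second. *)
pose w (X : {set gT}) := bd X * #|gT|.+1 + #|X|.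
case: (arg_minnP (P := frag) w frag1) => A0 fA0 minA0.
have [g Ag] : exists g, g \in A0 by case/andP: fA0 => /set0Pn.
pose A := g^-1 *: A0.
have trD (h : gT) (X : {set gT}) : #|(h *: X) * D| = #|X * D| by rewrite -mulgA card_lcoset.
have fragJ (h : gT) (X : {set gT}) : frag X -> frag (h *: X).
  case/andP=> X0 XD; apply/andP; split.
    by rewrite -card_gt0 card_lcoset card_gt0.
  by apply: contra XD; rewrite !eqEcard !subsetT /= trD.
have bdJ (h : gT) (X : {set gT}) : bd (h *: X) = bd X by rewrite /bd trD card_lcoset.
have fA : frag A by apply: fragJ.
have A1 : 1 \in A by rewrite mem_lcoset invgK mulg1.
have minA (X : {set gT}) : frag X -> bd A <= bd X.
  move=> fX; have := minA0 _ fX; rewrite /w bdJ.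
  have := max_card (mem X); card_nia.
have atomA (X : {set gT}) : frag X -> bd X <= bd A -> #|A| <= #|X|.
  move=> fX le; have := minA0 _ fX; have := minA _ fX.
  rewrite /w bdJ card_lcoset in le *.
  move: le; move: (bd A) (bd X) => a b.
  card_nia.
have stabA a : a \in A -> a^-1 *: A = A.
  move=> Aa; pose B := a^-1 *: A; apply/eqP; rewrite eq_sym.
  rewrite eqEcard card_lcoset leqnn andbT; apply/negPn/negP => AnB.
  have B1 : 1 \in B by rewrite mem_lcoset invgK mulg1.
  have fB : frag B by apply: fragJ.
  have pr : A :&: B \proper A.
    rewrite properEneq subsetIl andbT; apply: contra AnB.
    by move/eqP/setIidPl.
  have subI : (A :&: B) * D \subset (A * D) :&: (B * D).
    by rewrite subsetI !mulSg ?subsetIl ?subsetIr.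
  have fI : frag (A :&: B).
    apply/andP; split; first by apply/set0Pn; exists 1; rewrite inE A1.
    case/andP: fA => _; apply: contra; rewrite -!subTset => /subset_trans; apply.
    by rewrite mulSg ?subsetIl.
  have ltI : bd A < bd (A :&: B).
    rewrite ltnNge; apply/negP => /(atomA _ fI).
    by rewrite leqNgt proper_card.
  have cB : #|B| = #|A| by rewrite card_lcoset.
  have cBD : #|B * D| = #|A * D| by rewrite trD.
  have subU : (A :|: B) * D = (A * D) :|: (B * D).
    apply/setP=> x; rewrite !inE; apply/mulsgP/orP.
      by case=> y d /setUP[] ? ? ->; [left|right]; rewrite mem_mulg.
    by case=> /mulsgP[y d ? ? ->]; exists y d; rewrite // inE; apply/orP; auto.
  move: ltI; rewrite ltnNge bd_le -ltnNge.
  have [fd bdd] := dual fA; have := atomA _ fd bdd.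
  have := cardsUI A B; have := subset_leq_card subI.
  have := cardsUI (A * D) (B * D); rewrite -subU cB cBD.
  have [fU|] := boolP (frag (A :|: B)).
    have := minA _ fU; rewrite bd_le; clear.
    card_lia.
  rewrite /frag negb_and !negbK => /orP[/eqP U0|/eqP ->].
    by have : 1 \in A :|: B by [rewrite inE A1]; rewrite U0 inE.
  have : 0 < #|A :&: B| by apply/card_gt0P; exists 1; rewrite inE A1.
  have := cardsC (A * D); rewrite cardsT; clear.
  card_lia.
have grA : group_set A.
  apply/group_setP; split=> // x y Ax Ay.
  by move: Ay; rewrite -{1}(stabA x Ax) mem_lcoset invgK.
exists (Group grA); case/andP: (fA) => _ AD; split=> //= X X0 XD.
have /minA : frag X by apply/andP.
by rewrite bd_le.
Qed.

End Isoperimetry.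

(** * Translates of a set *)

Lemma card_mul_dvd (gT : finGroupType) (K : {group gT}) (X : {set gT}) : #|K| %| #|K * X|.
Proof.
pose P := preim_partition (fun x => K :* x) (K * X).
apply/dvdnP; exists #|P|; apply: card_uniform_partition (preim_partitionP _ _) => A.
case/imsetP=> x KDx ->; transitivity #|K :* x|; last exact: card_rcoset.
apply: eq_card => y.
rewrite inE; apply/andP/idP => [[_ /eqP E]|yKx].
  by have := rcoset_refl K y; rewrite -E.
split; last by apply/eqP/esym/rcoset_eqP.
case/rcosetP: yKx => k Kk ->; case/mulsgP: KDx => l d Kl Dd ->.
by rewrite mulgA mem_mulg ?groupM.
Qed.

(** By [atom_subgroup], testing subgroups is enough to bound |XD| - |X| for all X. *)
Definition expands (gT : finGroupType) (D : {set gT}) kap :=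
  forall K : {group gT}, K * D != setT -> kap + #|K| <= #|K * D|.

Section Growth.
Variable (gT : finGroupType) (D : {set gT}).
Hypotheses (D1 : 1 \in D) (DV : D^-1 = D) (Dgen : <<D>> = setT).

(** D meets K and, since it generates, some coset Kd.  If KD were K :|: Kd, then
    d^2 would be in K by symmetry, KD would be a group containing D, and KD
    would be everything. *)
Lemma card_mul_subgroup (K : {group gT}) : abelian [set: gT] -> K * D != setT ->
  exists2 c, 3 <= c & #|K * D| = (c * #|K|)%N.
Proof.
move=> abG KDn; have /dvdnP[c cKD] := card_mul_dvd K D; exists c => //.
have comm (x y : gT) : x * y = y * x by apply: (centsP abG); rewrite inE.
have [d Dd dK] : exists2 d, d \in D & d \notin K.
  apply/subsetPn; apply: contra KDn => DK.
  by rewrite -subTset -Dgen (subset_trans _ (mulg_subl _ D1)) ?gen_subG.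
pose M := K :|: K :* d.
have MnKD : ~~ (K * D \subset M).
  apply: contra KDn => sub.
  have d2 : d * d \in K.
    have: d^-1 \in M.
      apply: (subsetP sub); rewrite -[d^-1]mul1g mem_mulg //.
      by rewrite -DV mem_invg invgK.
    rewrite !inE groupV (negbTE dK) /= mem_rcoset -invMg groupV //.
  have grM : group_set M.
    apply/group_setP; split=> [|x y]; first by rewrite inE group1.
    rewrite !inE !mem_rcoset => /orP[xK|xK] /orP[yK|yK].
    - by rewrite groupM.
    - by apply/orP; right; rewrite -mulgA groupM.
    - by apply/orP; right; rewrite -mulgA (comm y) mulgA groupM.
    - have -> : x * y = (x * d^-1) * (y * d^-1) * (d * d).
        by rewrite -!mulgA (comm d^-1) !mulgA mulgKV -!mulgA mulgV mulg1.
      by apply/orP; left; rewrite groupM // groupM.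
  rewrite -subTset -Dgen.
  have /subset_trans -> // : <<D>> \subset Group grM.
    by rewrite gen_subG (subset_trans _ sub) // mulg_subr.
  rewrite /= /M subUset mulg_subl //=; apply/subsetP=> x /rcosetP[k Kk ->].
  by rewrite mem_mulg.
case/subsetPn: MnKD => _ /mulsgP[k e Kk De ->]; rewrite !inE negb_or.
rewrite !mem_rcoset -mulgA !(groupMl _ Kk) => /andP[eK eKd].
have : #|K :|: K :* d| < #|K * D|.
  apply/proper_card/properP; split.
    rewrite subUset mulg_subl //; apply/subsetP=> x /rcosetP[l Kl ->].
    by rewrite mem_mulg.
  exists (k * e); first exact: mem_mulg.
  by rewrite !inE mem_rcoset -mulgA !(groupMl _ Kk) negb_or eK.
have -> : #|K :|: K :* d| = (2 * #|K|)%N.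
  have := cardsUI K (K :* d); rewrite card_rcoset.
  suff -> : K :&: K :* d = set0 by rewrite cards0 addn0 => ->; rewrite mul2n addnn.
  apply/setP=> x; rewrite !inE mem_rcoset; apply/negP=> /andP[Kx].
  by rewrite (groupMl _ Kx) groupV (negbTE dK).
by rewrite cKD ltn_pmul2r ?cardG_gt0.
Qed.

Lemma card_mul_ge kap (X : {set gT}) :
  expands D kap ->
  X != set0 -> minn #|gT| (#|X| + kap) <= #|X * D|.
Proof.
move=> kapP X0; have [XD|XD] := eqVneq (X * D) setT.
  by rewrite XD -cardsT geq_minl.
have DnT : D != setT.
  case/set0Pn: X0 => x Xx; apply: contra XD => /eqP ->.
  rewrite -subTset; apply/subsetP=> y _.
  by rewrite -(mulKVg x y) mem_mulg ?inE.
have [K [KD /(_ X X0 XD)]] := atom_subgroup D1 DV DnT.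
rewrite geq_min; have := kapP K KD; card_lia.
Qed.

Lemma expg_mem1 j : 1 \in D ^+ j.
Proof.
elim: j => [|j IHj]; first by rewrite expg0 inE.
by rewrite expgS -[1]mulg1 mem_mulg.
Qed.

Lemma card_expg_ge kap j :
  expands D kap ->
  minn #|gT| (#|D| + j * kap) <= #|D ^+ j.+1|.
Proof.
move=> kapP; elim: j => [|j IHj]; first by rewrite addn0 geq_minr.
have D0 : D ^+ j.+1 != set0.
  by apply/set0Pn; exists 1; apply: expg_mem1.
have := card_mul_ge kapP D0; rewrite -expgSr mulSn; move: IHj; card_lia.
Qed.

Lemma expg_subS j : D ^+ j \subset D ^+ j.+1.
Proof. by rewrite expgSr; apply/subsetP=> x Dx; rewrite -[x]mulg1 mem_mulg. Qed.

End Growth.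

Section Defect.
Variable gT : finGroupType.
Implicit Types (S : {set gT}) (d e : gT).

Definition defect S d := #|S :* d :\: S|.

Lemma card_setI_rcoset S d : #|S :&: S :* d| = #|S| - defect S d.
Proof.
rewrite /defect; have := cardsID S (S :* d).
rewrite card_rcoset setIC; card_lia.
Qed.

Lemma defect_le S d : defect S d <= #|S|.
Proof. by rewrite -(card_rcoset S d) subset_leq_card // subsetDl. Qed.

Lemma defect1 S : defect S 1 = 0.
Proof. by rewrite /defect mulg1 setDv cards0. Qed.

Lemma defectM S d e : defect S (d * e) <= defect S d + defect S e.
Proof.
rewrite /defect -(card_rcoset (S :* d :\: S) e) -cardsUI.
apply: leq_trans (leq_addr _ _); apply/subset_leq_card/subsetP=> x.
rewrite !inE !mem_rcoset invMg mulgA !inE !mem_rcoset => /andP[-> ->].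
by case: (_ \in S).
Qed.

Lemma defectV S d : defect S d^-1 = defect S d.
Proof.
have E : #|S :&: S :* d^-1| = #|S :&: S :* d|.
  rewrite -(card_rcoset _ d) -[LHS](card_rcoset _ d) !card_rcoset.
  rewrite -(card_rcoset (S :&: S :* d^-1) d); apply: eq_card => x.
  by rewrite !mem_rcoset !inE !mem_rcoset invgK mulgKV andbC.
have := defect_le S d; have := defect_le S d^-1; move: E; rewrite !card_setI_rcoset.
lia.
Qed.

(** Each pair of elements of S is counted once, by its difference. *)
Lemma sum_card_setI_rcoset S : (\sum_d #|S :&: S :* d| = #|S| ^ 2)%N.
Proof.
transitivity (\sum_d \sum_(x in S) ((x * d^-1)%g \in S))%N.
  apply: eq_bigr => d _; rewrite -sum1_card big_mkcond [RHS]big_mkcond.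
  apply: eq_bigr => x _; rewrite !inE mem_rcoset; by case: (x \in S).
rewrite exchange_big -mulnn -sum_nat_const; apply: eq_bigr => x Sx.
rewrite -sum1_card [RHS]big_mkcond /= (reindex_inj (h := fun y => y^-1 * x)) /=; last first.
  by move=> y z /mulIg/invg_inj.
by apply: eq_bigr => y _; rewrite invMg invgK mulgA mulgV mul1g; case: (_ \in _).
Qed.

(** An element that first appears in X j contributes at least |S| - m j to the
    sum of the |S :&: S :* d|, and this is what it contributes on the left: m
    for each of the r - j sets X i with j <= i < r, and |S| - m r for X r. *)
Lemma card_defect_layers S (X : nat -> {set gT}) m r : (m * r <= #|S|)%N ->
  (forall j, j < r -> X j \subset X j.+1) ->
  (forall j d, j <= r -> d \in X j -> defect S d <= m * j)%N ->
  (m * (\sum_(j < r) #|X j|) + (#|S| - m * r) * #|X r| <= #|S| ^ 2)%N.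
Proof.
move=> mr sub def; rewrite -sum_card_setI_rcoset.
have card_ind (A : {set gT}) : #|A| = (\sum_d (d \in A))%N.
  by rewrite -sum1_card big_mkcond; apply: eq_bigr => d _; case: (_ \in _).
suff pt (d : gT) : (m * (\sum_(j < r) (d \in X j)) + (#|S| - m * r) * (d \in X r)
    <= #|S :&: S :* d|)%N.
  apply: leq_trans (leq_sum _ (fun d _ => pt d)).
  rewrite big_split -!big_distrr exchange_big -card_ind /=.
  by under [X in (_ <= _ * X + _)%N]eq_bigr do rewrite -card_ind.
rewrite card_setI_rcoset.
have nest k t : (forall j, j < t -> X j \subset X j.+1) -> k <= t -> X k \subset X t.
  elim: t => [|t IHt] subt; first by rewrite leqn0 => /eqP ->.
  rewrite leq_eqVlt => /orP[/eqP -> //|kt].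
  by apply: subset_trans (subt t _) => //; apply: IHt => // j /leqW; apply: subt.
elim: r => [|r IHr] in mr sub def *.
  rewrite big_ord0 !muln0 subn0; have [dX|_] := boolP (d \in X 0); last by rewrite muln0.
  by have := def 0 d isT dX; rewrite muln0 leqn0 muln1 => /eqP ->; rewrite subn0.
rewrite big_ord_recr /=; have mr' : (m * r <= #|S|)%N by lia.
have := IHr mr' (fun j jr => sub j (ltnW jr)) (fun j d jr => def j d (leqW jr)).
have := subsetP (sub r (ltnSn r)) d; have := def r.+1 d (leqnn _).
have [dr _ /(_ isT) ->|dr D1 _] := boolP (d \in X r).
  by move: mr; rewrite /= !muln1 mulnDr !mulnS; lia.
have -> : (\sum_(i < r) (d \in X i) = 0)%N.
  apply: big1 => i _; case: (boolP (_ \in _)) => // di; case/negP: dr.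
  by apply: subsetP di; apply: nest (ltnW (ltn_ord i)) => j /leqW; apply: sub.
move=> _; case: (boolP (d \in _)) D1 => [_ /(_ isT)|_ _]; lia.
Qed.

End Defect.

(** * Subset sums *)

Section Sums.
Variable G : finZmodType.
Implicit Types (A B : {set G}) (b d : G).

Lemma subset_sums0 : subset_sums (set0 : {set G}) = [set 1].
Proof.
by rewrite /subset_sums powerset0 imset_set1 big_set0.
Qed.

Lemma subset_sumsU1 b B : b \notin B ->
  subset_sums (b |: B) = subset_sums B :|: subset_sums B :* b.
Proof.
move=> bB; apply/setP=> x; rewrite inE mem_rcoset; apply/imsetP/orP.
  case=> C; rewrite inE => sub ->; have [bC|bC] := boolP (b \in C).
    right; apply/imsetP; exists (C :\ b).
      by rewrite inE subDset.
    rewrite (big_setD1 b) //=.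
    by rewrite FinRing.zmodMgE FinRing.zmodVgE GRing.addrAC GRing.subrr GRing.add0r.
  left; apply/imsetP; exists C; rewrite // inE; apply/subsetP=> y yC.
  by have := subsetP sub y yC; rewrite !inE => /orP[/eqP E|//]; rewrite -E yC in bC.
case=> /imsetP[C]; rewrite inE => sub.
  by move=> ->; exists C; rewrite // inE subsetU // sub orbT.
move=> E; exists (b |: C); first by rewrite inE setUS.
rewrite (big_setU1 b) /=; last by apply: contra bB => /(subsetP sub).
by rewrite -E FinRing.zmodMgE FinRing.zmodVgE GRing.addrC GRing.subrK.
Qed.

Lemma subset_sumsD1 b B : b \in B ->
  subset_sums B = subset_sums (B :\ b) :|: subset_sums (B :\ b) :* b.
Proof. by move=> bB; rewrite -subset_sumsU1 ?setD1K // setD11. Qed.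

Lemma mem1_subset_sums B : 1 \in subset_sums B.
Proof. by apply/imsetP; exists set0; rewrite ?inE ?sub0set // big_set0. Qed.

Lemma subset_sums_gen B : subset_sums B \subset <<B>>.
Proof.
apply/subsetP=> _ /imsetP[C + ->]; rewrite inE => sub.
apply: (big_ind (fun x : G => x \in <<B>>)) => [|x y|x xC].
- exact: group1.
- exact: groupM.
- by rewrite mem_gen // (subsetP sub).
Qed.

Lemma zero_sum_freeS A B : A \subset B -> zero_sum_free B -> zero_sum_free A.
Proof. by move=> sub zB C sC; apply: zB; apply: subset_trans sub. Qed.

Lemma card_subset_sumsD1 b B : b \in B ->
  #|subset_sums B| = #|subset_sums (B :\ b)| + defect (subset_sums (B :\ b)) b.
Proof.
move=> bB; rewrite (subset_sumsD1 bB) /defect.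
have := cardsUI (subset_sums (B :\ b)) (subset_sums (B :\ b) :* b).
have := cardsID (subset_sums (B :\ b)) (subset_sums (B :\ b) :* b).
rewrite setIC; card_lia.
Qed.

(** With T the sums that avoid b, the translate of S by b exceeds S only by
    elements of the translate by b of (T :* b) :\: T, and the latter set has
    |S| - |T| elements. *)
Lemma defect_subset_sums b B : b \in B ->
  #|subset_sums (B :\ b)| + defect (subset_sums B) b <= #|subset_sums B|.
Proof.
move=> bB; rewrite (card_subset_sumsD1 bB) leq_add2l (subset_sumsD1 bB) /defect.
set T := subset_sums _; rewrite -(card_rcoset (T :* b :\: T) b).
apply/subset_leq_card/subsetP=> x; rewrite !(inE, mem_rcoset).
by case: (x * b^-1 \in T); rewrite ?orbT ?orbF // => /andP[].
Qed.

Lemma zero_sum_free_notin b B : zero_sum_free B -> b \in B ->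
  b^-1 \notin subset_sums (B :\ b).
Proof.
move=> zB bB; apply/negP=> /imsetP[C]; rewrite inE => sub E.
have bC : b \notin C by apply/negP=> /(subsetP sub); rewrite setD11.
apply: (zB (b |: C)).
- by rewrite subUset sub1set bB (subset_trans sub) ?subD1set.
- by apply/set0Pn; exists b; rewrite setU11.
by rewrite big_setU1 //= -E; apply: (mulgV b).
Qed.

Lemma zero_sum_freeU1 B b : zero_sum_free B -> b^-1 \notin subset_sums B ->
  b \notin B -> zero_sum_free (b |: B).
Proof.
move=> zB nb bB C sub C0; have [bC|bC] := boolP (b \in C).
  rewrite (big_setD1 b bC) /= => E; case/negP: nb; apply/imsetP; exists (C :\ b).
    by rewrite inE subDset.
  apply: (mulgI b); rewrite mulgV; exact/esym.
apply: zB => //; apply/subsetP=> y yC; have := subsetP sub y yC.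
by rewrite !inE => /orP[/eqP E|//]; rewrite -E yC in bC.
Qed.

Lemma zero_sum_free_neq1 b B : zero_sum_free B -> b \in B -> b != 1.
Proof.
move=> zB bB; have := zero_sum_free_notin zB bB; apply: contra => /eqP ->.
by rewrite invg1 mem1_subset_sums.
Qed.

Lemma mem_subset_sums B b : b \in B -> b \in subset_sums B.
Proof.
move=> bB; apply/imsetP; exists [set b]; first by rewrite inE sub1set.
by rewrite big_set1.
Qed.

(** Otherwise b would be a difference of two elements of <<B :\ b>>. *)
Lemma subset_sums_double b B : zero_sum_free B -> b \in B -> <<B>> = setT ->
  <<B :\ b>> != setT -> #|subset_sums B| = (2 * #|subset_sums (B :\ b)|)%N.
Proof.
move=> zB bB genB gen'; rewrite (card_subset_sumsD1 bB) mul2n -addnn; congr (_ + _).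
rewrite /defect; have -> : subset_sums (B :\ b) :* b :\: subset_sums (B :\ b) = subset_sums (B :\ b) :* b.
  apply/setDidPl; rewrite disjoint_sym -setI_eq0; apply/eqP/setP=> x; rewrite !inE mem_rcoset.
  apply/negP=> /andP[/(subsetP (subset_sums_gen _)) xM /(subsetP (subset_sums_gen _)) yM].
  case/negP: gen'; rewrite -subTset -genB gen_subG; apply/subsetP=> y yB.
  have [->|yb] := eqVneq y b; last by rewrite mem_gen // !inE yb.
  have : (x * b^-1)^-1 * x \in <<B :\ b>> by rewrite groupM // groupV.
  by rewrite invMg invgK mulgKV.
by rewrite card_rcoset.
Qed.

Definition involution_free B := forall b, b \in B -> b ^+ 2 != 1.

Definition sym_closure B : {set G} := 1 |: (B :|: B^-1).

Lemma sym1 B : 1 \in sym_closure B.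
Proof. by rewrite !inE eqxx. Qed.

Lemma symV B : (sym_closure B)^-1 = sym_closure B.
Proof.
by apply/setP=> x; rewrite !inE invgK eq_invg1; congr (_ || _); apply: orbC.
Qed.

Lemma sym_gen B : <<sym_closure B>> = <<B>>.
Proof.
apply/eqP; rewrite eqEsubset !gen_subG; apply/andP; split; apply/subsetP=> x.
  rewrite !inE => /or3P[/eqP ->|xB|xB]; first exact: group1.
    exact: mem_gen.
  by rewrite -groupV mem_gen.
by move=> xB; rewrite mem_gen // !inE xB orbT.
Qed.

Lemma card_sym B : zero_sum_free B ->
  #|sym_closure B| + #|B :&: B^-1| = (2 * #|B|).+1.
Proof.
move=> zB; rewrite cardsU1 -addnA cardsUI card_invg.
have -> : 1 \notin B :|: B^-1.
  rewrite !inE invg1 orbb; apply/negP=> B1.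
  by have := zero_sum_free_neq1 zB B1; rewrite eqxx.
by rewrite mul2n -addnn.
Qed.

(** If b^-1 is in B and differs from b, then b and b^-1 form a zero-sum subset. *)
Lemma mem_involutions B b : zero_sum_free B -> b \in B :&: B^-1 -> b ^+ 2 = 1.
Proof.
move=> zB; rewrite !inE => /andP[bB vB]; have := zero_sum_free_notin zB bB.
have [E _|ne] := eqVneq b^-1 b; first by rewrite expgS expg1 -{1}E mulVg.
by rewrite mem_subset_sums // !inE ne.
Qed.

Lemma cyclic_involution (x y : G) : cyclic [set: G] -> x ^+ 2 = 1 -> y ^+ 2 = 1 ->
  x != 1 -> y != 1 -> x = y.
Proof.
move=> cG x2 y2 x1 y1.
have ord2 (z : G) : z ^+ 2 = 1 -> z != 1 -> #[z] = 2.
  by move=> z2 z1; apply: nt_prime_order.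
have: <[x]> :==: <[y]>.
  by rewrite (eq_subG_cyclic cG) ?subsetT // -!orderE !ord2.
move/eqP/setP/(_ x); rewrite cycle_id => /esym.
rewrite cycle_traject ord2 //= !inE (negbTE x1) /= mulg1.
by move/eqP.
Qed.

(** A cyclic group has at most one involution, and only an involution can be in
    both B and B^-1. *)
Lemma card_sym_ge B : cyclic [set: G] -> zero_sum_free B -> 2 * #|B| <= #|sym_closure B|.
Proof.
move=> cG zB; have := card_sym zB.
suff : #|B :&: B^-1| <= 1 by card_lia.
rewrite leqNgt; apply/negP => /card_gt1P[x [y [xI yI]]].
have B1 z : z \in B :&: B^-1 -> z != 1 by case/setIP=> /(zero_sum_free_neq1 zB).
by rewrite (cyclic_involution cG (mem_involutions zB xI) (mem_involutions zB yI)) ?B1 ?eqxx.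
Qed.

Lemma card_sym_eq B : zero_sum_free B -> involution_free B ->
  #|sym_closure B| = (2 * #|B|).+1.
Proof.
move=> zB noinv; have := card_sym zB; suff -> : B :&: B^-1 = set0 by rewrite cards0 addn0.
apply/setP=> x; rewrite [RHS]inE; apply/negP=> xI; have := mem_involutions zB xI.
by move/eqP; apply/negP; apply: noinv; case/setIP: xI.
Qed.

Lemma defect_sym B m : (forall b, b \in B -> #|subset_sums B| <= m + #|subset_sums (B :\ b)|) ->
  forall d, d \in sym_closure B -> defect (subset_sums B) d <= m.
Proof.
move=> Tm d; rewrite !inE => /or3P[/eqP ->|dB|dB]; first by rewrite defect1.
  have := Tm _ dB; have := defect_subset_sums dB; card_lia.
have := Tm _ dB; have := defect_subset_sums dB; rewrite defectV; card_lia.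
Qed.

End Sums.

(** * Small moduli *)

(** A subset of Z_n is encoded by its characteristic sequence.  The conditionals
    replace boolean connectives, whose arguments call-by-value reduction would
    always evaluate. *)
Fixpoint or_bits (v w : bitseq) : bitseq :=
  match v, w with
  | x :: v', y :: w' => (if x then true else y) :: or_bits v' w'
  | _, _ => [::]
  end.

Fixpoint more_bits (s : nat) (w : bitseq) : bool :=
  match w with
  | [::] => false
  | x :: w' => if x then (if s is s'.+1 then more_bits s' w' else true) else more_bits s w'
  end.

Definition add_bits (n a : nat) (w : bitseq) := or_bits w (rot (n - a) w).

(** The tree of the sets obtained by adding k elements of l to a set whose
    subset sums are w.  A branch is cut when the new element a is such that -a
    is already a sum, or when there are already more than s0 sums. *)
Fixpoint search (n s0 : nat) (l : seq nat) (k : nat) (w : bitseq) : bool :=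
  if k is k'.+1 then
    if l is a :: l' then
      if (if nth false w (n - a) then true else
          let w' := add_bits n a w in
          if more_bits s0 w' then true else search n s0 l' k' w')
      then search n s0 l' k w else false
    else true
  else more_bits s0 w.

Definition unit_bits n : bitseq := true :: nseq n.-1 false.

Definition search_upto N s0 k :=
  all (fun n => search n s0 (iota 1 n.-1) k (unit_bits n)) (iota 1 N).

Fixpoint zero_sum_free_seq n (l : seq nat) : bool :=
  if l is a :: l' then
    [&& 0 < a < n, ~~ nth false (foldr (add_bits n) (unit_bits n) l') (n - a),
        a \notin l' & zero_sum_free_seq n l']
  else true.

Lemma more_bitsE s w : more_bits s w = (s < count id w).
Proof.
elim: w s => [|[] w IHw] s //=; rewrite ?add0n ?IHw //.
by case: s => [|s]; rewrite ?IHw.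
Qed.

Lemma size_or_bits v w : size v = size w -> size (or_bits v w) = size w.
Proof. by elim: v w => [|x v IHv] [|y w] //= /eqP; rewrite eqSS => /eqP/IHv ->. Qed.

Lemma nth_or_bits v w i : size v = size w ->
  nth false (or_bits v w) i = nth false v i || nth false w i.
Proof.
elim: v w i => [|x v IHv] [|y w] //= i => [_|/eqP]; first by rewrite !nth_nil.
rewrite eqSS => /eqP E; case: i => [|i] /=; first by case: x.
exact: IHv.
Qed.

Section Bits.
Variable p : nat.
Local Notation n := p.+1.
Local Notation G := 'I_p.+1.
Implicit Types (B : {set G}) (w : bitseq).

Definition bits_of w (S : {set G}) :=
  size w = n /\ forall x : G, nth false w x = (x \in S).

Lemma bits_unit : bits_of (unit_bits n) (subset_sums set0).
Proof.
rewrite subset_sums0; split=> [|x]; first by rewrite /= size_nseq.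
rewrite inE -val_eqE; case: x => [[|i] lti] //.
have -> : nth false (unit_bits n) i.+1 = nth false (nseq p false) i by [].
by rewrite nth_nseq if_same.
Qed.

Lemma bits_add w S (a : G) : 0 < a -> bits_of w S ->
  bits_of (add_bits n a w) (S :|: S :* a).
Proof.
move=> a0 [sw wS]; have sr : size w = size (rot (n - a) w) by rewrite size_rot.
split=> [|x]; first by rewrite size_or_bits -?sr.
rewrite nth_or_bits // wS !inE mem_rcoset; congr (_ || _).
rewrite -wS /rot nth_cat size_drop sw.
have ltx := ltn_ord x; have lta := ltn_ord a.
have -> : nat_of_ord (x * a^-1) = (x + (n - a)) %% n.
  by rewrite /= modnDmr.
case: ltnP => [lt|le].
  by rewrite nth_drop modn_small addnC //; lia.
rewrite nth_take; last by lia.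
have -> : n - (n - a) = a by lia.
have -> : x + (n - a) = x - a + n by lia.
by rewrite modnDr modn_small //; lia.
Qed.

Lemma bits_opp w S (a : G) : 0 < a -> bits_of w S -> nth false w (n - a) = (a^-1 \in S).
Proof.
move=> a0 [_ <-]; congr nth; rewrite /= modn_small //; have := ltn_ord a; lia.
Qed.

Lemma bits_count w (S : {set G}) : bits_of w S -> count id w = #|S|.
Proof.
case=> sw wS; have -> : #|S| = \sum_(i < n) (i \in S).
  by rewrite -sum1_card big_mkcond; apply: eq_bigr => i _; case: (_ \in _).
rewrite -sum1_count big_mkcond (big_nth false) sw big_mkord.
by apply: eq_bigr => i _; rewrite -wS; case: nth.
Qed.

Lemma search_sound s0 l k w B0 B1 :
  all (fun a => 0 < a < n) l -> bits_of w (subset_sums B0) ->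
  search n s0 l k w -> #|B1| = k -> (forall x, x \in B1 -> nat_of_ord x \in l) ->
  [disjoint B0 & B1] -> zero_sum_free (B0 :|: B1) ->
  s0 < #|subset_sums (B0 :|: B1)|.
Proof.
elim: l k w B0 B1 => [|a l IHl] [|k] w B0 B1 /=.
- by move=> _ wB; rewrite more_bitsE (bits_count wB) => ? /eqP; rewrite cards_eq0 => /eqP ->; rewrite setU0.
- move=> _ _ _ cB B1l; have /card_gt0P[x /B1l //] : 0 < #|B1| by rewrite cB.
- by move=> _ wB; rewrite more_bitsE (bits_count wB) => ? /eqP; rewrite cards_eq0 => /eqP ->; rewrite setU0.
case/andP=> /andP[a0 an] ln wB + cB B1l dis zB.
pose b : G := Ordinal an.
case: ifP => // sa sl; have [bB|bB] := boolP (b \in B1); last first.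
  apply: IHl sl _ _ _ _ => // x xB; have := B1l x xB; rewrite inE => /orP[/eqP E|//].
  by case/negP: bB; rewrite (_ : b = x) //; apply: val_inj.
have bB0 : b \notin B0.
  by apply/negP=> bB0; move/pred0P/(_ b): dis; rewrite /= bB0 bB.
have EB : B0 :|: B1 = (b |: B0) :|: (B1 :\ b).
  by apply/setP=> x; rewrite !inE; case: eqP => [->|_] /=; rewrite ?bB ?orbT.
have wB' : bits_of (add_bits n a w) (subset_sums (b |: B0)).
  by rewrite subset_sumsU1 //; apply: (bits_add (a := b)).
have nb : nth false w (n - a) = false.
  rewrite (bits_opp (a := b) a0 wB); apply/negbTE.
  have zb : zero_sum_free (b |: B0).
    by apply: zero_sum_freeS zB; rewrite EB subsetUl.
  by have := zero_sum_free_notin zb (setU11 _ _); rewrite setU1K.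
move: sa; rewrite nb more_bitsE (bits_count wB'); case: ifP => [lt _|_ sa].
  apply: leq_trans lt _; apply/subset_leq_card/subsetP=> x /imsetP[C].
  rewrite EB inE => sub ->; apply/imsetP; exists C; rewrite // inE.
  by rewrite (subset_trans sub) // subsetUl.
rewrite EB; apply: IHl wB' sa _ _ _ _ => //.
- by move: cB; rewrite (cardsD1 b) bB => -[].
- move=> x; rewrite !inE => /andP[xb /B1l]; rewrite inE => /orP[/eqP E|//].
  by case/eqP: xb; apply: val_inj.
- rewrite -setI_eq0; apply/eqP/setP=> x; rewrite !inE.
  case: (x =P b) => //= _; by move/pred0P/(_ x): dis.
- by rewrite -EB.
Qed.

Lemma search_upto_sound N s0 k B : search_upto N s0 k -> n <= N ->
  zero_sum_free B -> #|B| = k -> s0 < #|subset_sums B|.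
Proof.
move=> /allP/(_ n) sN nN zB cB; rewrite -[B]set0U.
apply: search_sound (bits_unit) (sN _) cB _ _ _; rewrite ?set0U //.
- by apply/allP=> a; rewrite mem_iota; lia.
- by rewrite mem_iota; lia.
- move=> x xB; rewrite mem_iota; have := ltn_ord x; have := zero_sum_free_neq1 zB xB.
  rewrite -val_eqE /= ; lia.
by rewrite -setI_eq0 set0I.
Qed.

Lemma zero_sum_free_seqP l : zero_sum_free_seq n l ->
  exists2 B : {set G}, zero_sum_free B & #|B| = size l.
Proof.
move=> zl; suff [B [zB cB _ _]] : exists B : {set G}, [/\ zero_sum_free B, #|B| = size l,
    (forall x, x \in B -> nat_of_ord x \in l)
    & bits_of (foldr (add_bits n) (unit_bits n) l) (subset_sums B)].
  by exists B.
elim: l zl => [|a l IHl] /= => [_|].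
  exists set0; split; rewrite ?cards0 //; last exact: bits_unit.
  - by move=> C; rewrite subset0 => ->.
  - by move=> x; rewrite inE.
case/and4P=> /andP[a0 an] nb al /IHl[B [zB cB Bl wB]]; pose b : G := Ordinal an.
have bB : b \notin B by apply: contra al => /Bl.
exists (b |: B); split.
- by apply: zero_sum_freeU1; rewrite // -(bits_opp (a := b) a0 wB).
- by rewrite cardsU1 bB cB.
- by move=> x; rewrite !inE => /orP[/eqP ->|/Bl ->]; rewrite ?eqxx ?orbT.
by rewrite subset_sumsU1 //; apply: (bits_add (a := b)).
Qed.

End Bits.

(** * Reduction to generating sets *)

Section Transport.
Variables (G H : finZmodType) (f : G -> H).
Hypotheses (f_inj : injective f) (f1 : f 1 = 1) (fM : {morph f : x y / x * y}).

Lemma morph_sum (C : {set G}) : f (\sum_(b in C) b)%R = (\sum_(b in f @: C) b)%R.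
Proof. by rewrite big_imset /=; [apply: (big_morph f fM f1) | move=> x y _ _ /f_inj]. Qed.

Lemma zero_sum_free_imset (B : {set G}) : zero_sum_free (f @: B) -> zero_sum_free B.
Proof.
move=> zB C sub C0 E; apply: (zB (f @: C)).
- exact: imsetS.
- by case/set0Pn: C0 => x xC; apply/set0Pn; exists (f x); rewrite imset_f.
by rewrite -morph_sum E; apply: f1.
Qed.

Lemma card_subset_sums_imset (B : {set G}) : #|subset_sums (f @: B)| = #|subset_sums B|.
Proof.
rewrite -[RHS](card_imset _ f_inj); apply: eq_card => x; apply/imsetP/imsetP.
  case=> C; rewrite inE => sub ->; exists (\sum_(b in f @^-1: C :&: B) b)%R.
    by apply/imsetP; exists (f @^-1: C :&: B); rewrite // inE subsetIr.
  rewrite morph_sum; apply: eq_bigl => y; apply/idP/imsetP.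
    move=> yC; case/imsetP: (subsetP sub y yC) => z zB E.
    by exists z; rewrite // !inE zB -E yC.
  by case=> z; rewrite !inE => /andP[zC _] ->.
case=> _ /imsetP[C + ->] ->; rewrite inE => sub.
by exists (f @: C); rewrite ?inE ?imsetS // morph_sum.
Qed.

End Transport.

Lemma cyclic_ord p : cyclic [set: 'I_p.+1].
Proof. by rewrite (Zp_cycle p) cycle_cyclic. Qed.

(** B lies in a cyclic subgroup <[g]> of order q + 1, which is a copy of Z_(q+1)
    through the powers of g. *)
Lemma reduce_modulus p (B : {set 'I_p.+1}) : zero_sum_free B -> <<B>> != setT ->
  exists q (B' : {set 'I_q.+1}), [/\ q < p, zero_sum_free B', #|B'| = #|B|
    & #|subset_sums B'| = #|subset_sums B|].
Proof.
move=> zB genB; have /cyclicP[g Eg] := cyclicS (subsetT <<B>>) (cyclic_ord p).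
have og : #[g] < p.+1.
  rewrite /order -Eg -[p.+1]card_ord -cardsT; apply: proper_card.
  by rewrite properT.
have g0 := order_gt0 g; pose q := #[g].-1; have Eq : q.+1 = #[g] by rewrite prednK.
pose f (x : 'I_q.+1) : 'I_p.+1 := g ^+ x.
have f_inj : injective f.
  move=> x y /eqP; rewrite eq_expg_mod_order -Eq !modn_small // => /eqP.
  exact: val_inj.
have f1 : f 1 = 1 by rewrite /f expg0.
have fM : {morph f : x y / x * y}.
  by move=> x y; rewrite /f -expgD -[in RHS](expg_mod_order g) -[in RHS]Eq.
have EB : f @: (f @^-1: B) = B.
  apply/setP=> x; apply/imsetP/idP => [[y]|xB]; first by rewrite inE => yB ->.
  have : x \in <[g]> by rewrite -Eg mem_gen.
  case/cycleP=> i Ei; have lt : i %% #[g] < q.+1 by rewrite Eq ltn_mod.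
  by exists (Ordinal lt); rewrite ?inE /f /= expg_mod_order -Ei.
exists q, (f @^-1: B); split.
- by rewrite -ltnS Eq; lia.
- by apply: (zero_sum_free_imset f_inj f1 fM); rewrite EB.
- by rewrite -(card_imset _ f_inj) EB.
by rewrite -[in RHS]EB (card_subset_sums_imset f_inj f1 fM).
Qed.

Definition sums_bound k F := forall p (B : {set 'I_p.+1}),
  zero_sum_free B -> #|B| = k -> F <= #|subset_sums B|.

(** Induction on the modulus: a set that does not generate is moved to a smaller
    modulus. *)
Lemma sums_bound_large N k F : search_upto N F.-1 k -> 0 < F ->
  (forall p (B : {set 'I_p.+1}), N <= p -> zero_sum_free B -> #|B| = k ->
     <<B>> = setT -> F <= #|subset_sums B|) ->
  sums_bound k F.
Proof.
move=> sN F0 gen p; have [m] := ubnP p; elim: m p => // m IHm p pm B zB cB.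
have [genB|genB] := eqVneq <<B>> setT; last first.
  case: (reduce_modulus zB genB) => q [B' [qp zB' cB' <-]].
  by apply: IHm => //; [lia | rewrite cB'].
have [Np|pN] := leqP N p; first exact: gen.
by rewrite -(prednK F0); apply: search_upto_sound sN _ zB cB.
Qed.

(** * The counting argument *)

(** The inequality of [card_defect_layers] fails for some r, when layer 0 has
    at least x0 elements and layer j + 1, the (j + 1)-fold sumset of D, at least
    min(N, d + j kap).  Everything is numerical, so that the applications
    below are decided by computation. *)
Definition overfull N x0 d kap m s : bool :=
  has (fun r => (m * r.+1 <= s) &&
    (s ^ 2 < m * (x0 + sumn [seq minn N (d + j * kap) | j <- iota 0 r])
             + (s - m * r.+1) * minn N (d + r * kap))) (iota 0 s).

Section Large.
Variable G : finZmodType.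
Implicit Types (B D S : {set G}) (b : G).

(** Layer 0 may be any set X0 of elements of defect 0; an invariance of S makes
    it larger than {1}. *)
Lemma not_overfull D S (X0 : {set G}) N x0 d kap m :
  1 \in D -> D^-1 = D -> N <= #|G| -> X0 \subset D -> x0 <= #|X0| -> d <= #|D| ->
  (forall x, x \in X0 -> defect S x = 0) ->
  (forall x, x \in D -> defect S x <= m) ->
  expands D kap ->
  ~~ overfull N x0 d kap m #|S|.
Proof.
move=> D1 DV NG XD X0x dD def0 defm kapP; apply/hasPn=> r _.
rewrite negb_and -leqNgt -implybE; apply/implyP=> mr.
pose X j : {set G} := if j is j'.+1 then D ^+ j else X0.
have XS j : j < r.+1 -> X j \subset X j.+1.
  by case: j => [|j] _ /=; [rewrite expg1 | apply: expg_subS].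
have defX j x : j <= r.+1 -> x \in X j -> defect S x <= (m * j)%N.
  move=> _; case: j => [/def0 -> //|j]; rewrite /X.
  elim: j x => [|j IHj] x; first by rewrite expg1 muln1; apply: defm.
  rewrite expgSr => /mulsgP[y z /IHj Hy /defm Hz ->].
  by apply: leq_trans (defectM _ _ _) _; rewrite mulnS addnC leq_add.
apply: leq_trans (card_defect_layers mr XS defX).
have cX j : minn N (d + j * kap) <= #|X j.+1|.
  apply: leq_trans (card_expg_ge D1 DV j kapP).
  by rewrite leq_min !geq_min NG /= leq_add2r dD orbT.
apply: leq_add; last by rewrite leq_mul2l cX orbT.
rewrite leq_mul2l big_ord_recl /= sumnE big_map -[r in iota 0 r]subn0 -/(index_iota 0 r) big_mkord.
by apply/orP; right; apply: leq_add => //; apply: leq_sum => j _; apply: cX.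
Qed.

(** If KD consists of c >= 3 cosets of K, then |KD| - |K| is (1 - 1/c)|KD|, at
    least 2|D|/3. *)
Lemma expands_two_thirds D d kap : 1 \in D -> D^-1 = D -> <<D>> = setT ->
  d <= #|D| -> 3 * kap <= 2 * d + 2 ->
  expands D kap.
Proof.
move=> D1 DV Dgen dD kd K KD.
have [c c3 cE] := card_mul_subgroup D1 DV Dgen (FinRing.zmod_abelian _) KD.
have : #|D| <= #|K * D| by rewrite subset_leq_card // mulg_subr.
rewrite cE; move: dD; move: #|D| #|K| => x k; nia.
Qed.

(** If all subsets B :\ b have at least T0 sums and S has s, the elements of B have
    defect at most s - T0; every s between T0 and F is then excluded. *)
Lemma sums_ge_expands B N d kap T0 F : zero_sum_free B -> <<B>> = setT -> N <= #|G| ->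
  d <= #|sym_closure B| -> B != set0 ->
  (forall b, b \in B -> T0 <= #|subset_sums (B :\ b)|) ->
  expands (sym_closure B) kap ->
  all (fun s => overfull N 1 d kap (s - T0) s) (iota T0 (F - T0)) ->
  F <= #|subset_sums B|.
Proof.
move=> zB genB NG dD B0 TB kapP chk; rewrite leqNgt; apply/negP=> sF.
have /negP[] : ~~ overfull N 1 d kap (#|subset_sums B| - T0) #|subset_sums B|.
  apply: (@not_overfull (sym_closure B) _ [set 1]) => //; rewrite ?symV ?sym1 ?cards1 //.
  - by rewrite sub1set sym1.
  - by move=> x /set1P ->; rewrite defect1.
  apply: defect_sym => b bB; have := TB b bB; lia.
apply: (allP chk); case/set0Pn: B0 => b bB; rewrite mem_iota.
have := TB b bB; have := card_subset_sumsD1 bB; lia.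
Qed.

End Large.

(** * Subset sums up to signs *)

Section Structure.
Variable G : finZmodType.
Implicit Types (A B T : {set G}) (a b h x : G).

Let mulC (x y : G) : x * y = y * x := FinRing.zmod_mulgC x y.

Lemma subset_sums_flip A a : a \notin A -> a^-1 \notin A ->
  subset_sums (a |: A) = subset_sums (a^-1 |: A) :* a.
Proof.
by move=> aA vA; rewrite !subset_sumsU1 // mulUg setUC -rcosetM mulVg mulg1.
Qed.

(** Replacing an element a by its inverse translates the set of subset sums by a;
    this is repeated until A becomes B. *)
Lemma subset_sums_signs A B : A :&: A^-1 = set0 -> B :&: B^-1 = set0 ->
  1 \notin A -> 1 \notin B ->
  sym_closure A = sym_closure B -> exists t, subset_sums A = subset_sums B :* t.
Proof.
have asym (C : {set G}) : C :&: C^-1 = set0 -> forall z, z \in C -> z^-1 \notin C.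
  move=> E z zC; apply/negP=> vC.
  by have : z \in C :&: C^-1; [rewrite !inE zC vC | rewrite E inE].
move=> AV; move En: #|A :\: B| => n; elim: n A AV En => [|n IHn] A AV En BV A1 B1 eqD.
  exists 1; rewrite mulg1; congr subset_sums; apply/eqP; rewrite eqEsubset.
  move/eqP: En; rewrite cards_eq0 setD_eq0 => sub; rewrite sub /=.
  apply/subsetP=> b bB; have : b \in sym_closure A by rewrite eqD !inE bB orbT.
  rewrite !inE => /or3P[/eqP E|//|vA]; first by rewrite -E bB in B1.
  by case/negP: (asym _ BV b bB); apply: (subsetP sub).
have [b] : exists b, b \in A :\: B by apply/card_gt0P; rewrite En.
rewrite inE => /andP[bB bA].
have vB : b^-1 \in B.
  have : b \in sym_closure B by rewrite -eqD !inE bA orbT.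
  rewrite !inE (negbTE bB) /= => /orP[/eqP E|//]; by rewrite -E bA in A1.
have vA := asym _ AV b bA.
pose A' := b^-1 |: (A :\ b).
have [t Et] : exists t, subset_sums A' = subset_sums B :* t.
  apply: IHn => //.
  - apply/setP=> z; rewrite !inE.
    rewrite (inj_eq invg_inj) (can2_eq invgK invgK).
    have [->|zb] := eqVneq z b; rewrite ?invgK ?bA /=.
      have [E|] := eqVneq b b^-1; last by rewrite ?eqxx.
      by rewrite -E bA in vA.
    have [->|zv] := eqVneq z b^-1; rewrite ?invgK ?eqxx /= ?andbF //=.
    by have := asym _ AV z; case: (z \in A) => //= /(_ isT) /negbTE ->.
  - move: En; rewrite (cardsD1 b) !inE bA bB => -[<-]; apply: eq_card => z; rewrite !inE.
    have [->|_] := eqVneq z b^-1; first by rewrite vB andbF.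
    by rewrite andbCA.
  - rewrite !inE negb_or; rewrite (negbTE A1) andbF andbT; apply: contra A1.
    by rewrite eq_sym eq_invg1 => /eqP <-.
  rewrite -eqD; apply/setP=> z; rewrite !inE (inj_eq invg_inj) (can2_eq invgK invgK).
  have [->|zb] := eqVneq z b; first by rewrite bA !orbT.
  have [->|zv] := eqVneq z b^-1; rewrite ?invgK ?bA ?orbT //=.
exists (t * b); rewrite rcosetM -Et -(setD1K bA) subset_sums_flip ?setD11 //.
by rewrite !inE negb_and vA orbT.
Qed.

Lemma pair_subset_sums A a b : a \in A -> b \in A -> a != b -> a * b \in subset_sums A.
Proof.
move=> aA bA ab; apply/imsetP; exists [set a; b].
  by rewrite inE subUset !sub1set aA.
by rewrite big_setU1 ?big_set1 ?inE.
Qed.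

End Structure.

(** * Sets that are periodic modulo a subgroup of order three *)

Section Layers.
Variables (G : finZmodType) (K : {group G}).
Implicit Types (A B T C : {set G}) (a b h x y z u : G).
Hypothesis K3 : #|K| = 3.

Local Notation q := (coset K).
Let mulC (x y : G) : x * y = y * x := FinRing.zmod_mulgC x y.

Let nK y : y \in 'N(K).
Proof.
by apply: (subsetP (sub_abelian_norm (FinRing.zmod_abelian [set: G]) (subsetT K))); rewrite inE.
Qed.

Let qM x y : q (x * y) = q x * q y. Proof. by rewrite morphM. Qed.
Let qV x : q x^-1 = (q x)^-1. Proof. by rewrite morphV. Qed.
Let qX x n : q (x ^+ n) = q x ^+ n. Proof. by rewrite morphX. Qed.
Let q1 x : (q x == 1) = (x \in K).
Proof. by apply/eqP/idP => [/coset_idr->//|/coset_id]. Qed.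
Let qE x y : (q x == q y) = (x \in K :* y).
Proof. by rewrite mem_rcoset -q1 qM qV -eq_mulgV1. Qed.

Let qK z y : z \in K -> q (z * y) = q y.
Proof. by rewrite qM -q1 => /eqP ->; rewrite mul1g. Qed.
Let qXM x i b : q (x ^+ i * b) = q x ^+ i * q b. Proof. by rewrite qM qX. Qed.

(** The shape of the new sums found in [layers_defect]: a whole coset and two
    elements of another one. *)
Lemma card_coset_pair (X : {set G}) h z u : h \in K -> h != 1 -> K :* z \subset X ->
  u \in X -> h * u \in X -> q u != q z -> 5 <= #|X|.
Proof.
move=> hK h1 zX uX hX; rewrite qE => uz.
have hu : h * u != u by apply: contra h1 => /eqP/(canRL (mulgK u)); rewrite mulgV => ->.
have hz : h * u \notin K :* z by apply: contra uz; rewrite !mem_rcoset -mulgA groupMl.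
apply: (@leq_trans #|h * u |: (u |: K :* z)|).
  by rewrite !cardsU1 card_rcoset K3 !inE negb_or uz hz hu.
by apply: subset_leq_card; rewrite !subUset !sub1set hX uX.
Qed.

(** T occupies the cosets K x^i for 0 <= i <= 3, fills the two middle ones and
    has two elements in each of the others.  Multiplying by b shifts these
    layers; since b is not in layers -1, 0, 1, the shift either carries both
    full layers out of T, or is by 2 or -2, and then a full layer and an end
    layer leave T. *)
Lemma layers_defect T h x b : h \in K -> h != 1 ->
  (forall j, 0 < j < 6 -> q x ^+ j != 1) ->
  (forall y i, 0 < i < 3 -> q y = q x ^+ i -> y \in T) ->
  (forall i, i \in [:: 0; 3]%N -> x ^+ i \in T /\ h * x ^+ i \in T) ->
  (forall y, y \in T -> exists2 i, i < 4 & q y = q x ^+ i) ->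
  q b != 1 -> q b != q x -> q b != (q x)^-1 ->
  5 <= defect T b.
Proof.
move=> hK h1 xord mid ends lay b0 b1 bV.
have notTV y j : 0 < j < 3 -> q y = q x ^- j -> y \notin T.
  move=> j3 Ey; apply/negP=> /lay[i i4]; rewrite Ey => E.
  have /eqP[] : q x ^+ (i + j) != 1 by apply: xord; lia.
  by rewrite expgD -E mulVg.
have notT y j : 3 < j < 6 -> q y = q x ^+ j -> y \notin T.
  move=> j6 Ey; apply/negP=> /lay[i i4]; rewrite Ey => E.
  have /eqP[] : q x ^+ (j - i) != 1 by apply: xord; lia.
  by apply: (mulIg (q x ^+ i)); rewrite -expgD subnK ?E ?mul1g //; lia.
have sub i : 0 < i < 3 -> (forall y, q y = q x ^+ i * q b -> y \notin T) ->
    K :* (x ^+ i * b) \subset T :* b :\: T.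
  move=> i3 nT; apply/subsetP=> y; rewrite -qE qXM => /eqP Ey.
  by rewrite inE nT // mem_rcoset (mid _ i) // qM qV Ey mulgK.
have mem y : y \in T -> y * b \notin T -> y * b \in T :* b :\: T.
  by move=> yT ybT; rewrite inE ybT mem_rcoset mulgK.
have [x0 hx0] := ends 0 isT; have [x3 hx3] := ends 3 isT.
(* A shift by 2 moves layers 2 and 3 to 4 and 5. *)
have [b2|b2] := eqVneq (q b) (q x ^+ 2).
  have n5 z : z \in K -> z * (x ^+ 3 * b) \notin T.
    move=> zK; apply: (notT _ 5) => //.
    by rewrite qK // qXM b2 -expgD.
  apply: (@card_coset_pair _ h (x ^+ 2 * b) (x ^+ 3 * b)) => //.
  - by apply: sub => // y; rewrite b2 -expgD; apply: (notT _ 4).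
  - by apply: mem => //; have := n5 1 (group1 _); rewrite mul1g.
  - by rewrite mulgA; apply: mem => //; rewrite -mulgA; apply: n5.
  - rewrite !qXM (inj_eq (mulIg _)) expgS -{2}[q x ^+ 2]mul1g (inj_eq (mulIg _)).
    by rewrite -[q x]expg1; apply: xord.
(* A shift by -2 moves layers 0 and 1 to -2 and -1. *)
have [b2V|b2V] := eqVneq (q b) (q x ^- 2).
  have n2 z : z \in K -> z * b \notin T.
    move=> zK; apply: (notTV _ 2) => //.
    by rewrite qK.
  apply: (@card_coset_pair _ h (x ^+ 1 * b) b) => //.
  - apply: sub => // y; rewrite b2V => E; apply: (notTV _ 1%N) => //.
    by rewrite E expg1 expgS expg1 invMg mulgA mulgV mul1g.
  - have := mem _ x0; rewrite expg0 mul1g; apply.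
    by have := n2 1 (group1 _); rewrite mul1g.
  - by have := mem _ hx0; rewrite expg0 mulg1; apply; apply: n2.
  - rewrite !qXM -{1}[q b]mul1g (inj_eq (mulIg _)) eq_sym; exact: xord.
(* Any other shift moves both full layers out of T. *)
have far i y : 0 < i < 3 -> q y = q x ^+ i * q b -> y \notin T.
  move=> i3 Ey; apply/negP=> /lay[j j4]; rewrite Ey => E.
  have {E} : q b = q x ^- i * q x ^+ j by rewrite -E mulKg.
  move: b0 b1 bV b2 b2V; case: i i3 {Ey} => [|[|[|]]] // _; case: j j4 => [|[|[|[|]]]] // _;
    rewrite ?expg0 ?mulg1 ?expgS ?expg0 ?mulg1 ?invMg ?mulgA ?mulVg ?mul1g ?mulgKV;
    move=> b0 b1 bV b2 b2V E;
    move: b0 b1 bV b2 b2V; rewrite E ?mulVg ?mul1g ?eqxx //.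
have mem' z : z \in K -> z * (x ^+ 2 * b) \in T :* b :\: T.
  move=> zK; rewrite mulgA; apply: mem; last first.
    apply: (far 2) => //; by rewrite -mulgA qK // qXM.
  by apply: (mid _ 2); rewrite // qK // qX.
apply: (@card_coset_pair _ h (x ^+ 1 * b) (x ^+ 2 * b)) => //.
- by apply: sub => // y; apply: far.
- by have := mem' 1 (group1 _); rewrite mul1g.
- exact: mem'.
- rewrite !qXM (inj_eq (mulIg _)) expgS -{2}[q x ^+ 1]mul1g (inj_eq (mulIg _)).
  by rewrite -[q x]expg1; apply: xord.
Qed.

Lemma defect_rcoset (S : {set G}) t b : defect (S :* t) b = defect S b.
Proof.
rewrite /defect -(card_rcoset (S :* b :\: S) t); apply: eq_card => y.
by rewrite !(inE, mem_rcoset) -!mulgA (mulC b^-1).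
Qed.

Lemma coset_sum C x : (forall c, c \in C -> q c = q x) ->
  q (\sum_(c in C) c)%R = q x ^+ #|C|.
Proof.
move En: #|C| => n; elim: n C En => [|n IHn] C En Cx.
  by move/eqP: En; rewrite cards_eq0 => /eqP ->; rewrite big_set0 expg0; apply: (coset_id (group1 K)).
have [c cC] : exists c, c \in C by apply/card_gt0P; rewrite En.
rewrite (big_setD1 c cC) /= -FinRing.zmodMgE qM Cx // IHn ?expgS //.
  by move: En; rewrite (cardsD1 c) cC => -[].
by move=> d /setD1P[_ /Cx].
Qed.

Lemma order_quotient x : #|G| > 15 -> <<x |: K>> = setT ->
  forall j, 0 < j < 6 -> q x ^+ j != 1.
Proof.
move=> G15 gen j j6; apply/negP=> /eqP xj.
have sub : [set: G] / K \subset <[q x]>.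
  rewrite -gen quotient_gen; last by apply/subsetP=> y _.
  rewrite gen_subG; apply/subsetP=> _ /morphimP[y _ + ->].
  rewrite !inE => /orP[/eqP ->|yK]; first exact: cycle_id.
  by rewrite /= (coset_id yK); apply: group1.
have oj : #[q x] <= j by apply: dvdn_leq; [lia | rewrite order_dvdn xj].
have := leq_trans (subset_leq_card sub) oj.
rewrite card_quotient; last by apply/subsetP=> y _.
have := Lagrange (subsetT K); rewrite K3 cardsT; move: G15 j6; rewrite /indexg; card_lia.
Qed.

(** Write D for the closure of A and h for a generator of K.  Since D has no
    involution, D consists of K, Kx and Kx^-1 for any x in D outside K.  So A
    agrees up to signs with h together with Kx, whose subset sums form layers of
    sizes 2, 3, 3, 2 as in [layers_defect]. *)
Lemma periodic_defect A : 15 < #|G| -> zero_sum_free A -> <<A>> = setT ->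
  involution_free A -> #|sym_closure A| = 9 ->
  K * sym_closure A = sym_closure A ->
  forall b, b \notin sym_closure A -> 5 <= defect (subset_sums A) b.
Proof.
move=> G15 zA genA noinv D9 KD b bD; set D := sym_closure A in D9 KD bD.
have D1 : 1 \in D := sym1 A.
have DV y : y \in D -> y^-1 \in D by rewrite -mem_invg /D symV.
have noinvD y : y \in D -> y != 1 -> y ^+ 2 != 1.
  rewrite /D !inE => /or3P[/eqP ->|/noinv //|/noinv]; first by rewrite eqxx.
  move=> + _; apply: contra; rewrite expgVn => /eqP ->; by rewrite invg1.
have KsD : K \subset D by rewrite -KD mulg_subl.
have KxD x : x \in D -> K :* x \subset D.
  by move=> xD; rewrite -KD mulgS // sub1set.
have [h hK h1] : exists2 h, h \in K & h != 1.
  by apply/trivgPn; rewrite trivg_card1 K3.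
have h3 : h ^+ 3 = 1 by rewrite -K3 expg_cardG.
have hV : h^-1 != h.
  apply: contra (noinvD h (subsetP KsD h hK) h1) => /eqP E.
  by rewrite expgS expg1 -{1}E mulVg.
have EK : K = [set 1; h; h^-1] :> {set G}.
  apply/eqP; rewrite eq_sym eqEcard !subUset !sub1set group1 groupV hK /= K3.
  by rewrite setUC cardsU1 cards2 !inE negb_or eq_invg1 h1 hV eq_sym h1.
have [x xD xK] : exists2 x, x \in D & x \notin K.
  by apply/subsetPn; apply/negP=> /subset_leq_card; rewrite D9 K3.
(* If x^2 is in K, then x^3 is an involution in Kx, hence in D. *)
have x2K : x ^+ 2 \notin K.
  apply/negP=> x2; have x3 : x ^+ 3 \in K :* x.
    by rewrite mem_rcoset expgSr mulgK.
  have x31 : x ^+ 3 != 1.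
    by apply: contra xK => /eqP E; rewrite -groupV -(mul1g x^-1) -E expgSr mulgK.
  have /eqP[] := noinvD _ (subsetP (KxD x xD) _ x3) x31.
  by rewrite -expgM mulnC expgM -K3 expg_cardG.
have xxV y : y \in K :* x -> y \notin K :* x^-1.
  rewrite !mem_rcoset invgK => yx; apply: contra x2K => yxV.
  by rewrite -(groupMl _ yx) expgS expg1 mulgA mulgKV.
have ED : D = K :|: (K :* x :|: K :* x^-1).
  apply/eqP; rewrite eq_sym eqEcard !subUset KsD !KxD ?DV //= D9.
  have I1 : K :* x :&: K :* x^-1 = set0.
    by apply/setP=> y; rewrite !in_set; apply/negP=> /andP[/xxV/negP].
  have I2 : K :&: (K :* x :|: K :* x^-1) = set0.
    apply/setP=> y; rewrite !inE !mem_rcoset invgK; apply/negP=> /andP[yK].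
    by rewrite !(groupMl _ yK) groupV orbb (negbTE xK).
  by rewrite !cardsU I1 I2 cards0 !subn0 !card_rcoset K3.
pose A' := h |: K :* x.
have hx : h \notin K :* x by rewrite mem_rcoset (groupMl _ hK) groupV.
have xA' k : k \in K -> k * x \in K :* x by move=> kK; rewrite mem_rcoset mulgK.
have [t Et] : exists t, subset_sums A = subset_sums A' :* t.
  apply: subset_sums_signs.
  - apply/setP=> y; rewrite [RHS]inE; apply/negP=> yI.
    have := mem_involutions zA yI; case/setIP: yI => /noinv/negP yA _ /eqP.
    exact: yA.
  - apply/setP=> y; rewrite !inE; apply/negP=> /andP[/orP[/eqP ->|yx] /orP[/eqP E|vx]].
    + by rewrite E eqxx in hV.
    + by move: vx; rewrite mem_rcoset groupMl ?groupV // (negbTE xK).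
    + by move: yx; rewrite -[y]invgK E mem_rcoset groupMl ?groupV // (negbTE xK).
    + case/negP: x2K; move: yx vx; rewrite !mem_rcoset => yx vx.
      have -> : x ^+ 2 = ((y * x^-1) * (y^-1 * x^-1))^-1.
        by rewrite !invMg !invgK (mulC x y^-1) -mulgA mulKVg expgS expg1.
      by rewrite groupV groupM.
  - by apply/negP=> /(zero_sum_free_neq1 zA); rewrite eqxx.
  - by rewrite !inE negb_or eq_sym h1 mem_rcoset mul1g groupV.
  rewrite -/D ED /A'; apply/setP=> y; rewrite !inE EK !inE.
  have vE : (y \in K :* x^-1) = (y^-1 \in K :* x).
    by rewrite !mem_rcoset -(groupV K (y * _)) invMg !invgK mulC.
  rewrite -!EK vE (can2_eq invgK invgK).
  by case: (y == 1); case: (y == h); case: (y == h^-1); case: (y \in _); case: (y^-1 \in _).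
rewrite Et defect_rcoset.
have genx : <<x |: K>> = setT.
  apply/eqP; rewrite -subTset -genA -(sym_gen A) gen_subG -/D ED.
  have KM : K \subset <<x |: K>> by apply: sub_gen; apply: subsetUr.
  have xM : x \in <<x |: K>> by rewrite mem_gen ?setU11.
  by rewrite !subUset KM !mul_subG ?sub1set ?groupV.
have xord := order_quotient G15 genx.
have subA' y : y \in subset_sums (K :* x) -> y \in subset_sums A' /\ h * y \in subset_sums A'.
  by move=> yS; rewrite subset_sumsU1 // !in_setU yS (mulC h) !mem_rcoset mulgK yS orbT.
apply: (layers_defect hK h1 xord).
- move=> y i i3 Ey; case: (subA' y _) => //.
  case: i i3 Ey => [|[|[|]]] // _ /eqP; rewrite -qX qE.
    by rewrite expg1; apply: mem_subset_sums.
  (* k x^2 must be a sum of two different elements k1 x, k2 x with k1 k2 = k: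
     take kh and h^-1, or 1 and h when these coincide, that is when k = h. *)
  case/rcosetP=> k kK ->; have [->|kh] := eqVneq k h.
    rewrite expgS expg1 mulgA -[x in _ * x]mul1g; apply: pair_subset_sums.
    - exact: xA'.
    - by apply: xA'.
    - by rewrite (inj_eq (mulIg _)).
  have -> : k * x ^+ 2 = (k * h * x) * (h^-1 * x).
    by rewrite expgS expg1 -!mulgA (mulC x (h^-1 * x)) -!mulgA mulKVg.
  apply: pair_subset_sums; rewrite ?xA' ?groupM ?groupV //.
  rewrite (inj_eq (mulIg _)); apply: contra kh => /eqP E.
  have E2 : h ^+ 2 = h^-1 by apply: (mulIg h); rewrite mulVg -expgSr.
  by rewrite -(mulgK h k) E -invMg -[h * h]/(h ^+ 2) E2 invgK.
- move=> i; rewrite !inE => /orP[] /eqP ->; apply: subA'.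
    by rewrite expg0 mem1_subset_sums.
  apply/imsetP; exists (K :* x); first by rewrite inE.
  have -> : K :* x = [set x; h * x; h^-1 * x].
    by rewrite EK !mulUg !mulg_set1 mul1g.
  have hx1 : h * x != h^-1 * x by rewrite (inj_eq (mulIg _)) eq_sym.
  have xhx k : k != 1 -> x != k * x by rewrite -{1}[x]mul1g (inj_eq (mulIg _)) eq_sym.
  rewrite -setUA !big_setU1 ?big_set1 /= ?inE ?negb_or ?xhx ?hx1 ?eq_invg1 //.
  by rewrite -!FinRing.zmodMgE (mulC h x) -(mulgA x h) mulKVg !expgS expg0 mulg1.
- move=> y; rewrite subset_sumsU1 // inE mem_rcoset => yS.
  have [y' Ey yS'] : exists2 y', q y = q y' & y' \in subset_sums (K :* x).
    case/orP: yS => [yS|yS]; first by exists y.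
    by exists (y * h^-1); rewrite // mulC qK ?groupV.
  rewrite Ey; case/imsetP: yS' => C; rewrite inE => sub ->.
  exists #|C|; first by have := subset_leq_card sub; rewrite card_rcoset K3.
  by apply: coset_sum => c /(subsetP sub); rewrite -qE => /eqP.
- by rewrite q1; apply: contra bD => /(subsetP KsD).
- by rewrite qE; apply: contra bD => /(subsetP (KxD x xD)).
- by rewrite -qV qE; apply: contra bD => /(subsetP (KxD _ (DV x xD))).
Qed.

End Layers.

(** * Large moduli *)

Section Counting.
Variable G : finZmodType.
Implicit Types (B : {set G}) (b : G).

Lemma involution_freeD1 B b : involution_free B -> involution_free (B :\ b).
Proof. by move=> nB a /setD1P[_ /nB]. Qed.

Lemma card_setD1 B b k : b \in B -> #|B| = k.+1 -> #|B :\ b| = k.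
Proof. by move=> bB; rewrite (cardsD1 b) bB => -[]. Qed.

(** The bound T0 may be assumed for all b, for if some B :\ b does not generate,
    the number of sums is at least 2 T1. *)
Lemma sums_or_double B T0 T1 F : zero_sum_free B -> <<B>> = setT ->
  (forall b, b \in B -> T1 <= #|subset_sums (B :\ b)|) -> F <= 2 * T1 ->
  (forall b, b \in B -> <<B :\ b>> = setT -> T0 <= #|subset_sums (B :\ b)|) ->
  F <= #|subset_sums B| \/ forall b, b \in B -> T0 <= #|subset_sums (B :\ b)|.
Proof.
move=> zB genB T1B FT1 T0B.
have [/exists_inP[b bB nT]|/exists_inPn all_gen] :=
    boolP [exists b in B, <<B :\ b>> != [set: G]].
  left; rewrite (subset_sums_double zB bB genB nT); have := T1B b bB; lia.
by right=> b bB; apply: T0B => //; apply/eqP; have := all_gen b bB; rewrite negbK.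
Qed.

Hypothesis G36 : 36 <= #|G|.

Lemma sums_ge_counting B d kap T0 F : zero_sum_free B -> <<B>> = setT ->
  d <= #|sym_closure B| -> 3 * kap <= 2 * d + 2 -> 0 < #|B| ->
  (forall b, b \in B -> T0 <= #|subset_sums (B :\ b)|) ->
  all (fun s => overfull 36 1 d kap (s - T0) s) (iota T0 (F - T0)) ->
  F <= #|subset_sums B|.
Proof.
move=> zB genB dD kd B0 TB chk.
apply: (@sums_ge_expands _ B 36 d kap T0 F zB genB G36 dD) => //.
  by rewrite -card_gt0.
by apply: expands_two_thirds dD kd; rewrite ?sym1 ?symV ?sym_gen.
Qed.

End Counting.

Lemma sums_boundP k F : sums_bound k F -> forall p (B : {set 'I_p.+1}) b,
  zero_sum_free B -> #|B| = k.+1 -> b \in B -> F <= #|subset_sums (B :\ b)|.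
Proof.
move=> bnd p B b zB cB bB; apply: bnd; last exact: card_setD1.
by apply: zero_sum_freeS zB; apply: subD1set.
Qed.

Lemma sums_bound_step k T0 F kap : search_upto 35 F.-1 k.+1 -> 0 < F ->
  sums_bound k T0 -> 3 * kap <= 2 * (2 * k.+1) + 2 ->
  all (fun s => overfull 36 1 (2 * k.+1) kap (s - T0) s) (iota T0 (F - T0)) ->
  sums_bound k.+1 F.
Proof.
move=> chk F0 bnd kd num; apply: (sums_bound_large chk) => // p B pN zB cB genB.
apply: (@sums_ge_counting _ _ B (2 * k.+1) kap T0 F) => //.
- by rewrite card_ord.
- by rewrite -cB; apply: card_sym_ge => //; apply: cyclic_ord.
- by rewrite cB.
- by move=> b bB; apply: (sums_boundP bnd zB cB bB).
Qed.

Lemma sums_bound1 : sums_bound 1 2.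
Proof.
move=> p B zB cB; have /card_gt0P[b bB] : 0 < #|B| by rewrite cB.
have b1 := zero_sum_free_neq1 zB bB.
apply: (@leq_trans #|[set 1; b]|); first by rewrite cards2 eq_sym b1.
by apply: subset_leq_card; rewrite subUset !sub1set mem1_subset_sums mem_subset_sums.
Qed.

Lemma sums_bound2 : sums_bound 2 4.
Proof.
apply: (@sums_bound_step 1 2 4 3 _ _ sums_bound1 _ _); by vm_compute.
Qed.
Lemma sums_bound3 : sums_bound 3 6.
Proof.
apply: (@sums_bound_step 2 4 6 4 _ _ sums_bound2 _ _); by vm_compute.
Qed.
Lemma sums_bound4 : sums_bound 4 9.
Proof.
apply: (@sums_bound_step 3 6 9 6 _ _ sums_bound3 _ _); by vm_compute.
Qed.

(** ** Sets without involutions *)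

Section InvolutionFree.
Variable p : nat.
Hypothesis pN : 35 <= p.
Implicit Types B : {set 'I_p.+1}.

Let G36 : 36 <= #|'I_p.+1|. Proof. by rewrite card_ord. Qed.

Lemma sums3_involution_free B : zero_sum_free B -> involution_free B -> #|B| = 3 ->
  <<B>> = setT -> 7 <= #|subset_sums B|.
Proof.
move=> zB nB cB genB; have D7 := card_sym_eq zB nB.
apply: (@sums_ge_counting _ G36 B 7 5 4) => //; rewrite ?D7 ?cB //.
by move=> b bB; apply: (sums_boundP sums_bound2 zB cB bB).
Qed.

(** The counting argument gives 11 as soon as D, which has 9 elements, expands by
    7; a subgroup K that prevents this has order 3 and KD = D.  The value 10
    does occur, for instance for h, x, x + h, x - h with 3h = 0. *)
Lemma sums4_involution_free B : zero_sum_free B -> involution_free B -> #|B| = 4 ->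
  <<B>> = setT -> 10 <= #|subset_sums B| /\
  (11 <= #|subset_sums B| \/ exists K : {group 'I_p.+1},
    #|K| = 3 /\ K * sym_closure B = sym_closure B).
Proof.
move=> zB nB cB genB; have := card_sym_eq zB nB; rewrite cB => D9.
have T7 b : b \in B -> <<B :\ b>> = setT -> 7 <= #|subset_sums (B :\ b)|.
  move=> bB; apply: sums3_involution_free; rewrite ?(card_setD1 bB cB) //.
    by apply: zero_sum_freeS zB; apply: subD1set.
  exact: involution_freeD1.
have [||ge11|{}T7] := @sums_or_double _ B 7 6 11 zB genB _ _ T7 => //.
- by move=> b bB; apply: (sums_boundP sums_bound3 zB cB bB).
- by split; [lia|left].
split; first by apply: (@sums_ge_counting _ G36 B 9 6 7); rewrite ?D9 ?cB.
have [/existsP[K /andP[K3 /eqP KD]]|/existsPn noK] :=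
  boolP [exists K : {group 'I_p.+1}, (#|K| == 3) && (K * sym_closure B == sym_closure B)].
  by right; exists K; split=> //; apply/eqP.
left; apply: (@sums_ge_expands _ B 36 9 7 7 11 zB genB G36); rewrite ?D9 //.
  by rewrite -card_gt0 cB.
move=> K KD; have := noK K; rewrite negb_and.
have genD : <<sym_closure B>> = setT by rewrite sym_gen.
have [c c3 cE] := card_mul_subgroup (sym1 B) (symV B) genD (FinRing.zmod_abelian _) KD.
have sub : sym_closure B \subset K * sym_closure B by rewrite mulg_subr.
have := subset_leq_card sub; rewrite [_ * _ == _]eq_sym eqEcard sub /= cE D9 -ltnNge.
move: (cardG_gt0 K); move: #|K| => k k0 ck /orP[k3|]; last by nia.
have [k4|] := leqP 4 k; first by nia.
case: k k0 k3 ck {cE} => [|[|[|[|]]]] // _ _; lia.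
Qed.

(** A subset of four elements with only 10 sums is periodic modulo a subgroup of
    order 3, and then the fifth element adds 5 sums. *)
Lemma sums5_involution_free B : zero_sum_free B -> involution_free B -> #|B| = 5 ->
  <<B>> = setT -> 15 <= #|subset_sums B|.
Proof.
move=> zB nB cB genB; have := card_sym_eq zB nB; rewrite cB => D11.
have [//|T11] : 15 <= #|subset_sums B| \/
    forall b, b \in B -> 11 <= #|subset_sums (B :\ b)|; last first.
  by apply: (@sums_ge_counting _ G36 B 11 8 11); rewrite ?D11 ?cB.
have [ge15|lt15] : 15 <= #|subset_sums B| \/ #|subset_sums B| < 15 by lia.
  by left.
apply: (@sums_or_double _ B 11 9 15 zB genB) => // [b bB|b bB genb].
  exact: (sums_boundP sums_bound4 zB cB bB).
have zb : zero_sum_free (B :\ b) by apply: zero_sum_freeS zB; apply: subD1set.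
have nb := involution_freeD1 (b := b) nB; have cb := card_setD1 bB cB.
have [ge10 []//] := sums4_involution_free zb nb cb genb.
case=> K [K3 KD]; have := card_sym_eq zb nb; rewrite cb => D9.
have bD : b \notin sym_closure (B :\ b).
  rewrite !inE eqxx /= negb_or (zero_sum_free_neq1 zB bB) /=.
  by have := zero_sum_free_notin zB bB; apply: contra => bV; apply: mem_subset_sums; rewrite !inE.
have G15 : 15 < #|'I_p.+1| by rewrite card_ord; lia.
have ge5 := periodic_defect K3 G15 zb genb nb D9 KD bD.
have /(leq_trans lt15) : 15 <= #|subset_sums B|.
  by rewrite (card_subset_sumsD1 bB); apply: (leq_add ge10 ge5).
by rewrite ltnn.
Qed.

End InvolutionFree.

(** ** Sets with an involution *)

Section Involution.
Variable p : nat.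
Hypothesis pN : 35 <= p.
Implicit Types B : {set 'I_p.+1}.

Let G36 : 36 <= #|'I_p.+1|. Proof. by rewrite card_ord. Qed.
Let mulC (x y : 'I_p.+1) : x * y = y * x := FinRing.zmod_mulgC x y.

Lemma subset_sums_involution B h : h \in B -> h ^+ 2 = 1 ->
  subset_sums B :* h = subset_sums B.
Proof.
move=> hB h2; have hh : h * h = 1 by [].
by rewrite (subset_sumsD1 hB) mulUg -rcosetM hh mulg1 setUC.
Qed.

Lemma subset_sums_even B h : h \in B -> h ^+ 2 = 1 -> h != 1 -> 2 %| #|subset_sums B|.
Proof.
move=> hB h2 h1; have o2 : #[h] = 2 by apply: nt_prime_order.
have E : <[h]> * subset_sums B = subset_sums B.
  apply/eqP; rewrite eqEsubset mulg_subr ?group1 // andbT.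
  apply/subsetP=> _ /mulsgP[_ s /cycleP[i ->] sB ->].
  elim: i => [|i IHi]; first by rewrite expg0 mul1g.
  by rewrite expgS -mulgA mulC -(subset_sums_involution hB h2) mem_rcoset mulgK.
by rewrite -o2 -E; apply: card_mul_dvd.
Qed.

(** The variant of [sums_ge_expands] for a set S with nontrivial stabiliser: layer 0
    consists of elements that stabilise S, and only even s remain. *)
Lemma sums_ge_stab B h (X0 : {set 'I_p.+1}) x0 d kap T0 s0 :
  zero_sum_free B -> h \in B -> h ^+ 2 = 1 -> X0 \subset sym_closure B -> x0 <= #|X0| ->
  (forall x, x \in X0 -> subset_sums B :* x = subset_sums B) ->
  d <= #|sym_closure B| ->
  (forall b, b \in B -> T0 <= #|subset_sums (B :\ b)|) ->
  expands (sym_closure B) kap ->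
  all (fun s => (2 %| s) ==> overfull 36 x0 d kap (s - T0) s) (iota T0 (s0 - T0)) ->
  s0 <= #|subset_sums B|.
Proof.
move=> zB hB h2 XD x0X stab dD TB kapP chk; rewrite leqNgt; apply/negP=> lt.
have h1 := zero_sum_free_neq1 zB hB.
have /negP[] : ~~ overfull 36 x0 d kap (#|subset_sums B| - T0) #|subset_sums B|.
  apply: (@not_overfull _ (sym_closure B) _ X0) => //.
  - exact: sym1.
  - exact: symV.
  - by move=> x /stab E; rewrite /defect E setDv cards0.
  by apply: defect_sym => b bB; have := TB b bB; card_lia.
have ev := subset_sums_even hB h2 h1.
have := allP chk #|subset_sums B|; rewrite ev; apply; rewrite mem_iota.
have := TB h hB; have := card_subset_sumsD1 hB; move: lt; card_lia.
Qed.

Lemma involution_stab B h : h \in B -> h ^+ 2 = 1 ->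
  forall x, x \in [set 1; h] -> subset_sums B :* x = subset_sums B.
Proof.
by move=> hB h2 x /set2P[] ->; [rewrite mulg1 | apply: subset_sums_involution].
Qed.

Lemma involution_sub B h : h \in B -> [set 1; h] \subset sym_closure B.
Proof. by move=> hB; rewrite subUset !sub1set sym1 !inE hB orbT. Qed.

Lemma sums5_involution B h : zero_sum_free B -> <<B>> = setT -> #|B| = 5 -> h \in B ->
  h ^+ 2 = 1 -> 14 <= #|subset_sums B|.
Proof.
move=> zB genB cB hB h2; have h1 := zero_sum_free_neq1 zB hB.
have D10 : 10 <= #|sym_closure B|.
  by apply: leq_trans (card_sym_ge (cyclic_ord p) zB); rewrite cB.
apply: (@sums_ge_stab B h [set 1; h] 2 10 7 9) => //.
- exact: involution_sub.
- by rewrite cards2 eq_sym h1.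
- exact: involution_stab.
- by move=> b bB; apply: (sums_boundP sums_bound4 zB cB bB).
by apply: expands_two_thirds D10 _; rewrite ?sym1 ?symV ?sym_gen.
Qed.

(** The elements g and g^2 together contribute all powers of g to the sums. *)
Lemma subset_sums_root B g : g \in B -> g ^+ 2 \in B -> g ^+ 2 != 1 -> g ^+ 4 = 1 ->
  subset_sums B :* g = subset_sums B.
Proof.
move=> gB hB h1 g4; have g1 : g != 1 by apply: contra h1 => /eqP ->; rewrite expg1n.
have gh : g != g ^+ 2 by rewrite -{1}[g]mulg1 expgS expg1 (inj_eq (mulgI _)) eq_sym.
have gB' : g \in B :\ g ^+ 2 by rewrite !inE gh.
rewrite (subset_sumsD1 hB) (subset_sumsD1 gB').
set V := subset_sums _; rewrite !mulUg -!rcosetM.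
have -> : g * (g ^+ 2 * g) = 1 by rewrite -expgSr -expgS.
have -> : g ^+ 2 * g = g * g ^+ 2 by rewrite -expgSr -expgS.
have -> : g * g = g ^+ 2 by [].
rewrite mulg1; apply/setP=> y; rewrite !in_setU.
by case: (y \in V); case: (y \in V :* g); case: (y \in V :* g ^+ 2); case: (y \in _).
Qed.

(** D expands by 9 unless D is a union of three cosets of a subgroup K of order 4
    contained in D.  A generator g of K is then in B up to sign, with g^2 = h.
    In that case S is invariant under K, and K serves as layer 0. *)
Lemma sums6_involution (bound5 : sums_bound 5 14) B h : zero_sum_free B -> <<B>> = setT ->
  #|B| = 6 -> h \in B -> h ^+ 2 = 1 -> 20 <= #|subset_sums B|.
Proof.
move=> zB genB cB hB h2; have h1 := zero_sum_free_neq1 zB hB.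
have cG := cyclic_ord p; have genD : <<sym_closure B>> = setT by rewrite sym_gen.
have D12 : 12 <= #|sym_closure B|.
  by apply: leq_trans (card_sym_ge cG zB); rewrite cB.
have T14 b : b \in B -> 14 <= #|subset_sums (B :\ b)|.
  by move=> bB; apply: (sums_boundP bound5 zB cB bB).
have hV : h^-1 = h by apply: (mulgI h); rewrite mulgV.
have [/exists_inP[g gB /eqP Eg]|/exists_inPn noroot] := boolP [exists g in B, g ^+ 2 == h].
  have g4 : g ^+ 4 = 1 by rewrite (expgM g 2 2) Eg h2.
  have og : #[g] = 4.
    have : #[g] %| 4 by rewrite order_dvdn g4.
    have : ~~ (#[g] %| 2) by rewrite order_dvdn Eg.
    by have := order_gt0 g; move: #[g] => [|[|[|[|[|n]]]]] // _ _ /dvdn_leq.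
  apply: (@sums_ge_stab B h <[g]> 4 12 8 14) => //.
  - apply/subsetP=> x; rewrite cycle_traject og /= !inE mulg1.
    have -> : g * g = h by [].
    have -> : g * h = g^-1 by apply: (mulIg g); rewrite mulVg -Eg -expgS -expgSr.
    by case/or4P=> /eqP ->; rewrite ?eqxx ?gB ?hB ?invgK ?gB ?orbT.
  - by rewrite -orderE og.
  - move=> _ /cycleP[i ->]; elim: i => [|i IHi]; first by rewrite expg0 mulg1.
    by rewrite expgSr rcosetM IHi subset_sums_root ?Eg.
  by apply: expands_two_thirds D12 _; rewrite ?sym1 ?symV.
apply: (@sums_ge_stab B h [set 1; h] 2 12 9 14) => //.
- exact: involution_sub.
- by rewrite cards2 eq_sym h1.
- exact: involution_stab.
move=> K KD; rewrite leqNgt; apply/negP=> lt.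
have [c c3 cE] := card_mul_subgroup (sym1 B) (symV B) genD (FinRing.zmod_abelian _) KD.
have sub : sym_closure B \subset K * sym_closure B by rewrite mulg_subr.
have leD := subset_leq_card sub.
have [K4 KD12] : #|K| = 4 /\ #|K * sym_closure B| = 12.
  move: leD lt D12; rewrite cE; move: #|sym_closure B| #|K| => x k xle lt x12.
  have k4 : k <= 4 by nia.
  by case: k k4 xle lt => [|[|[|[|[|k]]]]] // _ xle lt; lia.
have ED : K * sym_closure B = sym_closure B.
  by apply/eqP; rewrite eq_sym eqEcard sub KD12.
have /cyclicP[g Kg] := cyclicS (subsetT K) cG.
have og : #[g] = 4 by rewrite /order -Kg.
have gg1 : g ^+ 2 != 1 by rewrite -order_dvdn og.
have Eg : g ^+ 2 = h.
  by apply: (cyclic_involution cG) => //; apply/eqP; rewrite -expgM -order_dvdn og.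
have gD : g \in sym_closure B.
  by rewrite -ED; apply: (subsetP (mulg_subl _ (sym1 B))); rewrite Kg cycle_id.
move: gD; rewrite !inE => /or3P[/eqP E|gB|gB].
- by rewrite E expg1n eqxx in gg1.
- by have := noroot g gB; rewrite Eg eqxx.
by have := noroot _ gB; rewrite expgVn Eg hV eqxx.
Qed.

End Involution.

(** ** The minima *)

Lemma sums_bound5 : sums_bound 5 14.
Proof.
apply: (@sums_bound_large 35); [by vm_compute | by [] |].
move=> p B pN zB cB genB.
have [/exists_inP[h hB /eqP h2]|/exists_inPn noinv] := boolP [exists h in B, h ^+ 2 == 1].
  exact: sums5_involution h2.
by apply: ltnW; apply: sums5_involution_free.
Qed.

Lemma sums_bound6 : sums_bound 6 20.
Proof.
apply: (@sums_bound_large 35); [by vm_compute | by [] |].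
move=> p B pN zB cB genB.
have [/exists_inP[h hB /eqP h2]|/exists_inPn noinv] := boolP [exists h in B, h ^+ 2 == 1].
  exact: (sums6_involution pN sums_bound5 zB genB cB hB h2).
have G36 : 36 <= #|'I_p.+1| by rewrite card_ord.
have := card_sym_eq zB noinv; rewrite cB => D13.
have [|||//|T15] := @sums_or_double _ B 15 14 20 zB genB.
- by move=> b bB; apply: (sums_boundP sums_bound5 zB cB bB).
- by [].
- move=> b bB; apply: sums5_involution_free; rewrite ?(card_setD1 bB cB) //.
    by apply: zero_sum_freeS zB; apply: subD1set.
  exact: involution_freeD1.
by apply: (@sums_ge_counting _ G36 B 13 9 15); rewrite ?D13 ?cB.
Qed.

Lemma sums_bound7 : sums_bound 7 25.
Proof.
apply: (@sums_bound_step 6 20 25 10 _ _ sums_bound6 _ _); by vm_compute.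
Qed.

Lemma min_nat_eq (P : nat -> Prop) v : P v -> (forall m, P m -> v <= m) -> min_nat P = Some v.
Proof.
move=> Pv minv; rewrite /min_nat; case: pselect => [exP|[]]; last first.
  by exists v; apply/asboolP.
case: ex_minnP => m /asboolP Pm minm; congr Some; apply/eqP.
by rewrite eqn_leq minv // minm //; apply/asboolP.
Qed.

Lemma min_nat_sat (P : nat -> Prop) m : min_nat P = Some m -> P m.
Proof.
by rewrite /min_nat; case: pselect => // exP; case: ex_minnP => k /asboolP Pk _ [<-].
Qed.

Lemma f_value k p l : sums_bound k p.+1 -> zero_sum_free_seq p.+1 l -> size l = k ->
  f k = Some p.
Proof.
move=> bnd zl sl; apply: min_nat_eq.
  exists p.+1 => //; apply: min_nat_eq.
    have [B zB cB] := zero_sum_free_seqP zl; exists B; split; rewrite ?cB //.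
    have := bnd _ _ zB (etrans cB sl); have := max_card (mem (subset_sums B)).
    rewrite card_ord /=; card_lia.
  by move=> _ [B [zB cB ->]]; have := bnd _ _ zB cB; lia.
move=> m [n n0 /min_nat_sat[B [zB cB ->]]]; have := bnd _ _ zB cB; lia.
Qed.

Theorem theorem1p2 :
  [/\ f 4 = Some 8, f 5 = Some 13, f 6 = Some 19 & f 7 = Some 24].
Proof.
split.
- by apply: (@f_value 4 8 [:: 1; 3; 4; 7]%N sums_bound4); vm_compute.
- by apply: (@f_value 5 13 [:: 1; 2; 7; 8; 9]%N sums_bound5); vm_compute.
- by apply: (@f_value 6 19 [:: 1; 2; 3; 10; 11; 12]%N sums_bound6); vm_compute.
- by apply: (@f_value 7 24 [:: 1; 5; 6; 10; 11; 16; 21]%N sums_bound7); vm_compute.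
Qed.
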